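(* Let $A\in\mathbb{R}^{m\times n}$, $b\in\mathbb{R}^m$, $c\in\mathbb{R}^n$, and $X\subseteq\mathbb{Z}^n$. Suppose that the system $Ax\geq b$ is a rational single-row system, i.e., $m=1$ and all entries of $A$ and $b$ are rational. If $\inf\{c\cdot x\colon x\in X\}$ is finite, then $v^L=\bar v^\star=v^\star$.
   Context: Inequalities between vectors are componentwise, $\mathbb{R}_+^m$ is the set of vectors of $\mathbb{R}^m$ with nonnegative entries, and $\cdot$ is the standard inner product. $\operatorname{conv}(X)$ is the convex hull of $X$ and $\overline{\operatorname{conv}}(X)$ is the closure of $\operatorname{conv}(X)$. The dual function is $$\mathcal{G}(\lambda)=\inf\{c\cdot x+\lambda\cdot(b-Ax)\colon x\in X\}\in\mathbb{R}\cup\{\pm\infty\},\qquad \lambda\in\mathbb{R}_+^m,$$ and $v^L=\sup\{\mathcal{G}(\lambda)\colon\lambda\in\mathbb{R}_+^m\}$. Further, $v^\star=\inf\{c\cdot x\colon Ax\geq b,\ x\in\operatorname{conv}(X)\}$ and $\bar v^\star=\inf\{c\cdot x\colon Ax\geq b,\ x\in\overline{\operatorname{conv}}(X)\}$. Infima and suprema are taken in the extended reals, with $\inf\varnothing=+\infty$ (so ''finite'' for $\inf\{c\cdot x\colon x\in X\}$ means being a real number; in particular $X\neq\varnothing$). *)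

(* Defs.v *)
From HB Require Import structures.
From mathcomp Require Import all_boot all_order all_algebra.
From mathcomp Require Import all_classical all_reals all_analysis.

Set Implicit Arguments.
Unset Strict Implicit.
Unset Printing Implicit Defensive.

Import Order.TTheory GRing.Theory Num.Theory.
Import numFieldNormedType.Exports.

Local Open Scope classical_set_scope.
Local Open Scope ring_scope.

Definition dot (R : realType) (k : nat) (u v : 'cV[R]_k) : R :=
  \sum_i u i 0 * v i 0.

Definition vle (R : realType) (k : nat) (u v : 'cV[R]_k) : Prop :=
  forall i, u i 0 <= v i 0.

Definition conv_hull (R : realType) (k : nat) (X : set 'cV[R]_k) :
    set 'cV[R]_k :=
  smallest (@convex_set R 'cV[R]_k) X.

Definition closed_conv_hull (R : realType) (k : nat) (X : set 'cV[R]_k) :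
    set 'cV[R]_k :=
  closure (conv_hull X).

Section LagrangianDual.
Variables (R : realType) (m n : nat).
Variables (A : 'M[R]_(m, n)) (b : 'cV[R]_m) (c : 'cV[R]_n).

(* ereal_inf set0 = +oo. *)
Definition linear_inf (S : set 'cV[R]_n) : \bar R :=
  ereal_inf [set (dot c x)%:E | x in S].

Definition feasible : set 'cV[R]_n := [set x | vle b (A *m x)].

Variable X : set 'cV[R]_n.

Definition dual_fun (lam : 'cV[R]_m) : \bar R :=
  ereal_inf [set (dot c x + dot lam (b - A *m x))%:E | x in X].

Definition vL : \bar R :=
  ereal_sup [set dual_fun lam | lam in [set lam | vle 0 lam]].

Definition vstar : \bar R := linear_inf (feasible `&` conv_hull X).

Definition vstar_bar : \bar R := linear_inf (feasible `&` closed_conv_hull X).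

End LagrangianDual.

(* Main.v *)
Require Import Defs.
From HB Require Import structures.
From mathcomp Require Import all_boot all_order all_algebra.
From mathcomp Require Import all_classical all_reals all_analysis.
From mathcomp Require Import ring lra.

Set Implicit Arguments.
Unset Strict Implicit.
Unset Printing Implicit Defensive.

Import Order.TTheory GRing.Theory Num.Theory.
Import numFieldNormedType.Exports.

Local Open Scope classical_set_scope.
Local Open Scope ring_scope.

(** Weak duality holds because every Lagrangian lower bound cuts out a closed
    half-space containing [X].  Conversely, let [v] be a real lower bound for
    the primal problem over the convex hull, and let [d x = b - A x].  The
    multiplier is the supremum of [0] and the slopes [(v - c x) / d x] over the
    points of [X] with [d x > 0].  The supremum is finite because [c x] is
    bounded below on [X] and, by rationality and integrality, [d x] takes values
    in a lattice [Z / D], so that [d x > 0] forces [d x >= 1 / D].  Feasibility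
    of the point with [d = 0] on the segment joining two points of [X] with
    [d x < 0 < d y] shows that these slopes stay below those imposed by the
    points with [d x < 0]. *)

Section DotProduct.
Variables (R : realType) (k : nat).
Implicit Types u v x y : 'cV[R]_k.

Lemma dotE u v : dot u v = (u^T *m v) 0 0.
Proof. by rewrite mxE; apply: eq_bigr => i _; rewrite mxE. Qed.

Lemma dot_comb u (p q : R) x y :
  dot u (p *: x + q *: y) = p * dot u x + q * dot u y.
Proof. by rewrite !dotE mulmxDr -!scalemxAr !mxE. Qed.

Lemma dot_continuous u : continuous (dot u).
Proof.
apply: continuous_big => [|i _ x]; first exact: add_continuous.
by apply: (@cvgMl_tmp _ _ (nbhs x)); exact: coord_continuous.
Qed.

Lemma conv_hull_comb (X : set 'cV[R]_k) x y (p : R) : 0 <= p -> p <= 1 ->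
  conv_hull X x -> conv_hull X y -> conv_hull X (p *: x + (1 - p) *: y).
Proof.
move=> p0 p1 cx cy Y [/= Ycvx XY].
have {}cx : Y x by exact: cx.
have {}cy : Y y by exact: cy.
by have := Ycvx x y (Itv01 p0 p1) (mem_set cx) (mem_set cy); rewrite inE.
Qed.

(** The half-space is convex, so it contains the hull, and closed, so it also contains the
    closure. *)
Lemma closed_conv_hull_halfspace (X : set 'cV[R]_k) u (r : R) :
  (forall x, X x -> r <= dot u x) ->
  forall x, closed_conv_hull X x -> r <= dot u x.
Proof.
move=> Xr; set H := [set x | r <= dot u x].
have Hcvx : convex_set (H : set (convex_lmodType 'cV[R]_k)).
  move=> x y p; rewrite !inE => xH yH.
  have -> : H (conv p x y) = (r <= p%:num * dot u x + (1 - p%:num) * dot u y).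
    by rewrite -dot_comb.
  have p0 : 0 <= p%:num by [].
  have p1 : p%:num <= 1 by [].
  by rewrite /H /= in xH yH; nra.
have Hcl : closed H.
  have /continuous_closedP dotC := @dot_continuous u.
  exact: (dotC _ (@closed_ge R r)).
have XH : closure (conv_hull X) `<=` H.
  by rewrite closureE; apply: smallest_sub => //; exact: smallest_sub.
exact: XH.
Qed.

End DotProduct.

(** Both duality inequalities are tested on real lower bounds, which absorbs the infinite values. *)
Lemma lee_fin_below (R : realType) (d e : \bar R) :
  (forall r : R, (r%:E <= d)%E -> (r%:E <= e)%E) -> (d <= e)%E.
Proof.
case: d => [r||] de; [exact: de| |exact: leNye].
case: e de => [r||] // de; last by have := de 0 (leey _).
by have := de (r + 1) (leey _); rewrite lee_fin gerDl ler10.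
Qed.

Section WeakDuality.
Variables (R : realType) (m n : nat).
Variables (A : 'M[R]_(m, n)) (b : 'cV[R]_m) (c : 'cV[R]_n) (X : set 'cV[R]_n).

(** For fixed [lam] this turns a Lagrangian lower bound into a half-space with normal
    [c - A^T *m lam]. *)
Lemma lagrangian_affine lam x : dot c x + dot lam (b - A *m x) =
  dot (c - A^T *m lam) x + dot lam b.
Proof.
rewrite !dotE mulmxBr linearB /= trmx_mul trmxK mulmxBl mulmxA.
have mxB (M N : 'M[R]_1) : (M - N) 0 0 = M 0 0 - N 0 0 by rewrite !mxE.
by rewrite !mxB; ring.
Qed.

Lemma vL_le_vstar_bar : (vL A b c X <= vstar_bar A b c X)%E.
Proof.
apply: ge_ereal_sup => _ [lam lam0 <-].
apply: le_ereal_inf_tmp => _ [x [feas_x Xx] <-].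
apply: lee_fin_below => r /ereal_infP rX; rewrite lee_fin.
have : r - dot lam b <= dot (c - A^T *m lam) x.
  apply: closed_conv_hull_halfspace Xx => y Xy.
  rewrite lerBlDr -lagrangian_affine -lee_fin.
  by apply: rX; exists y.
rewrite lerBlDr -lagrangian_affine => /le_trans; apply.
rewrite gerDl sumr_le0 // => i _; apply: mulr_ge0_le0.
  by have := lam0 i; rewrite mxE.
by rewrite !mxE subr_le0; have := feas_x i; rewrite !mxE.
Qed.

Lemma vstar_bar_le_vstar : (vstar_bar A b c X <= vstar A b c X)%E.
Proof.
apply: ereal_inf_le_tmp => _ [x [fx Xx] <-]; exists x => //; split => //.
exact: subset_closure.
Qed.

End WeakDuality.

(** Here [s] is the cost and [d] the residual. The last hypothesis, divided by [d y - d x], bounds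
    by [v] the cost interpolated at residual zero between [x] and [y]. *)
Lemma exists_multiplier (R : realType) (T : Type) (X : set T) (s d : T -> R)
    (g D v : R) :
  0 <= D -> (forall x, X x -> 0 < d x -> 1 <= D * d x) ->
  (forall x, X x -> g <= s x) ->
  (forall x, X x -> d x <= 0 -> v <= s x) ->
  (forall x y, X x -> X y -> d x < 0 -> 0 < d y ->
    (v - s y) * - d x <= (s x - v) * d y) ->
  exists2 lam, 0 <= lam & forall x, X x -> v <= s x + lam * d x.
Proof.
move=> D0 gap sg vs cross.
pose E := [set l | l = 0 \/ exists y, [/\ X y, 0 < d y & l = (v - s y) / d y]].
have E0 : E 0 by left.
have ubE : has_ubound E.
  (* A positive slope has numerator at most [v - g], and [1 / d y] is at most [D]. *)
  exists (Num.max 0 ((v - g) * D)) => _ [->|[y [Xy dy ->]]].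
    by rewrite le_max lexx.
  rewrite le_max !ler_pdivrMr // mul0r.
  have := gap _ Xy dy; have := sg _ Xy.
  case: (leP (v - s y) 0) => //= vsy sgy Ddy.
  rewrite -mulrA; nra.
exists (sup E); first exact: ub_le_sup.
move=> x Xx; case: (ltgtP (d x) 0) => dx; last first.
- by rewrite dx mulr0 addr0 vs // dx.
- have : (v - s x) / d x <= sup E by apply: ub_le_sup => //; right; exists x.
  by rewrite ler_pdivrMr // lerBlDl.
(* A point with [d x < 0] caps the multiplier; [vs] puts [0] below the cap and [cross] the
   slopes. *)
- have : sup E <= (s x - v) / - d x.
    apply: ge_sup; first by exists 0.
    move=> _ [->|[y [Xy dy ->]]].
      by rewrite divr_ge0 ?subr_ge0 ?vs ?oppr_ge0 // ltW.
    by rewrite ler_pdivrMr // mulrAC ler_pdivlMr ?oppr_gt0 // cross.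
  rewrite ler_pdivlMr ?oppr_gt0 //; lra.
Qed.

Lemma ratr_denq (R : realType) (q : rat) :
  (denq q)%:~R * ratr q \is a @Num.int R.
Proof.
rewrite /ratr mulrC divfK ?intr_int // intr_eq0.
exact: denq_neq0.
Qed.

Lemma common_denominator (R : realType) (I : finType) (f : I -> R) :
  (forall i, exists q : rat, f i = ratr q) ->
  exists2 D : R, 0 < D & forall i, D * f i \is a Num.int.
Proof.
move=> /choice[q fq]; exists (\prod_i (denq (q i))%:~R).
  by apply: prodr_gt0 => i _; rewrite ltr0z denq_gt0.
move=> i; rewrite (bigD1 i) //= mulrAC fq rpredM ?ratr_denq //.
by apply: rpred_prod => j _; exact: intr_int.
Qed.

Section StrongDuality.
Variables (R : realType) (n : nat).
Variables (A : 'M[R]_(1, n)) (b : 'cV[R]_1) (c : 'cV[R]_n) (X : set 'cV[R]_n).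

Lemma residual_gap :
  (forall x, X x -> forall j, x j 0 \is a Num.int) ->
  (forall i j, exists q : rat, A i j = ratr q) ->
  (forall i, exists q : rat, b i 0 = ratr q) ->
  exists2 D : R, 0 < D & forall x, X x ->
    0 < (b - A *m x) 0 0 -> 1 <= D * (b - A *m x) 0 0.
Proof.
move=> X_int A_rat b_rat.
(* The index [None] carries [b], so that one denominator serves the whole row and the right-hand
   side. *)
pose f (o : option 'I_n) := if o is Some j then A 0 j else b 0 0.
have [|D D_gt0 fD] := @common_denominator R _ f.
  by case=> [j|]; [exact: A_rat|exact: b_rat].
exists D => // x Xx dx.
have Dd_int : D * (b - A *m x) 0 0 \is a Num.int.
  rewrite !mxE mulrBr rpredB ?(fD None) // mulr_sumr rpred_sum // => j _.
  by rewrite mulrA rpredM ?(fD (Some j)) // X_int.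
by rewrite -[leRHS]gtr0_norm ?norm_intr_ge1 ?mulr_gt0 // gt_eqF ?mulr_gt0.
Qed.

Lemma vstar_le_vL (g D : R) : 0 <= D ->
  (forall x, X x -> 0 < (b - A *m x) 0 0 -> 1 <= D * (b - A *m x) 0 0) ->
  (forall x, X x -> g <= dot c x) ->
  (vstar A b c X <= vL A b c X)%E.
Proof.
move=> D0 gap cg; apply: lee_fin_below => v /ereal_infP vle_conv.
have {}vle_conv x : conv_hull X x -> (b - A *m x) 0 0 <= 0 -> v <= dot c x.
  move=> cx dx; rewrite -lee_fin; apply: vle_conv; exists x => //; split => // i.
  by rewrite ord1; move: dx; rewrite !mxE subr_le0.
have XC : X `<=` conv_hull X by exact: sub_gen_smallest.
have [||lam lam0 vlam] := exists_multiplier (v := v) D0 gap cg.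
- by move=> x /XC; exact: vle_conv.
- move=> x y Xx Xy dx dy.
  set ex := (b - A *m x) 0 0 in dx *; set ey := (b - A *m y) 0 0 in dy *.
  have exy : 0 < ey - ex by lra.
  (* The weight solving [p * ex + (1 - p) * ey = 0]. *)
  pose p := ey / (ey - ex).
  have p0 : 0 <= p by apply: divr_ge0; lra.
  have p1 : p <= 1 by rewrite ler_pdivrMr //; lra.
  have pE : p * (ey - ex) = ey by rewrite /p divfK // gt_eqF.
  have := vle_conv _ (conv_hull_comb p0 p1 (XC _ Xx) (XC _ Xy)).
  have -> : (b - A *m (p *: x + (1 - p) *: y)) 0 0 = p * ex + (1 - p) * ey.
    rewrite mulmxDr -!scalemxAr /ex /ey !mxE; ring.
  rewrite dot_comb => vp.
  have : v <= p * dot c x + (1 - p) * dot c y by apply: vp; lra.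
  (* After scaling by [ey - ex], the weights [p] and [1 - p] become [ey] and [- ex]. *)
  rewrite -(ler_pM2r exy) => h; rewrite -subr_ge0.
  have : 0 <= (p * (ey - ex)) * dot c x + (ey - ex - p * (ey - ex)) * dot c y
    - v * (ey - ex) by lra.
  by rewrite pE; lra.
apply: le_ereal_sup_tmp; exists (dual_fun A b c X (const_mx lam)).
  by exists (const_mx lam) => // i; rewrite !mxE.
apply/ereal_infP => _ [x Xx <-]; rewrite lee_fin /dot big_ord1.
by rewrite [const_mx _ _ _]mxE; exact: vlam.
Qed.

End StrongDuality.

Theorem theorem1p4 (R : realType) (m n : nat)
    (A : 'M[R]_(m, n)) (b : 'cV[R]_m) (c : 'cV[R]_n) (X : set 'cV[R]_n)
    (X_int : forall x, X x -> forall j, x j 0 \is a Num.int)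
    (m_eq1 : m = 1%N)
    (A_rat : forall i j, exists q : rat, A i j = ratr q)
    (b_rat : forall i, exists q : rat, b i 0 = ratr q)
    (inf_fin : linear_inf c X \is a fin_num) :
  vL A b c X = vstar_bar A b c X /\ vstar_bar A b c X = vstar A b c X.
Proof.
subst m.
have [D D0 gap] := residual_gap X_int A_rat b_rat.
have cg x : X x -> fine (linear_inf c X) <= dot c x.
  by move=> Xx; rewrite -lee_fin fineK //; apply: ereal_inf_lbound; exists x.
have vv := vstar_le_vL (ltW D0) gap cg.
have LB := vL_le_vstar_bar A b c X.
have BS := vstar_bar_le_vstar A b c X.
(* The inequalities [LB], [BS] and [vv] form a cycle through the three values. *)
split; apply/eqP; rewrite eq_le.
- by rewrite LB (le_trans BS vv).
- by rewrite BS (le_trans vv LB).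
Qed.
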